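(* Let $X$ be a topological space with an open-finite basis $\mathcal{B}$ and let $P$ be an invariant property of descending sequences of open subsets of $X$. If Nonempty has a winning strategy in $\mathsf{Ch}_P(X)$, then Nonempty has a stationary winning strategy in $\mathsf{Ch}_P(X)$.
   Context: A basis $\mathcal{B}$ for a space is open-finite if for every $U \in \mathcal{B}$ the set $\{V \in \mathcal{B} : V \supseteq U\}$ is finite. A property of descending sequences of open sets of $X$ is a set $P$ of descending ($\supseteq$-decreasing) sequences $\langle U_i\rangle_{i<\omega}$ of open subsets of $X$. For descending sequences, write $\langle U_i\rangle_{i<\omega} \le \langle V_i\rangle_{i<\omega}$ if for each $V_j$ there is some $U_i$ with $U_i \subseteq V_j$, and write $\langle U_i\rangle_{i<\omega} \equiv \langle V_i\rangle_{i<\omega}$ if both $\langle U_i\rangle \le \langle V_i\rangle$ and $\langle V_i\rangle \le \langle U_i\rangle$. $P$ is invariant if $\langle V_i\rangle \in P$ and $\langle U_i\rangle \equiv \langle V_i\rangle$ imply $\langle U_i\rangle \in P$. The generalized Choquet game $\mathsf{Ch}_P(X)$ is played by Empty and Nonempty for $\omega$ rounds. On round $i$, Empty chooses a point $x_i\in X$ and an open set $U_i$ with $x_i \in U_i$ and, if $i\ge 1$, $U_i \subseteq V_{i-1}$; Nonempty responds with an open set $V_i$ with $x_i \in V_i \subseteq U_i$. Nonempty wins the play if and only if the descending sequence $U_0,V_0,U_1,V_1,\dots$ belongs to $P$ (for invariant $P$, equivalently $\langle V_i\rangle_{i<\omega} \in P$). A strategy for Nonempty is a function $\mathfrak{S}$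 which takes a partial play ending with a move by Empty (recorded as the sequence $\langle x_j,U_j\rangle_{j\le i}$ of Empty's moves) and returns a legal open set $V_i$ for Nonempty. It is winning if Nonempty wins every play that follows it, and stationary if $\mathfrak{S}(\langle x_j,U_j\rangle_{j\le i}) = \mathfrak{S}(\langle x_i,U_i\rangle)$ for every partial play $\langle x_j,U_j\rangle_{j\le i}$ of Empty against $\mathfrak{S}$. *)

(* Defs.v *)
From mathcomp Require Import all_boot all_order.
From mathcomp Require Import all_classical topology.

Set Implicit Arguments.
Unset Strict Implicit.
Unset Printing Implicit Defensive.

Local Open Scope classical_set_scope.

Section OpenFinite.
Context {X : topologicalType}.

Definition open_finite (B : set (set X)) : Prop :=
  forall U, B U -> finite_set [set V | B V /\ U `<=` V].

End OpenFinite.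

Section Properties.
Context {X : topologicalType}.
Implicit Types (U V : nat -> set X) (P : set (nat -> set X)).

Definition descending U : Prop :=
  (forall i, open (U i)) /\ (forall i j, (i <= j)%N -> U j `<=` U i).

Definition is_property P : Prop := P `<=` descending.

Definition seq_le U V : Prop := forall j, exists i, U i `<=` V j.

Definition seq_equiv U V : Prop := seq_le U V /\ seq_le V U.

Definition invariant_property P : Prop :=
  forall U V, descending U -> P V -> seq_equiv U V -> P U.

End Properties.

Section Game.
Context {X : topologicalType}.

Definition move : Type := (X * set X)%type.

(* A strategy answers the nonempty list of Empty's moves so far; its values on
   lists that are not partial plays against it are irrelevant. *)
Definition strategy : Type := seq move -> set X.

Implicit Types (S : strategy) (s : seq move) (m : move).
Implicit Types (x : nat -> X) (U V : nat -> set X) (P : set (nat -> set X)).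

(* The lists of Empty's moves of the partial plays, ending with a move by
   Empty, in which Nonempty's answers are given by S. *)
Inductive partial_play S : seq move -> Prop :=
| partial_play_start (x0 : X) (U0 : set X) :
    open U0 -> U0 x0 -> partial_play S [:: (x0, U0)]
| partial_play_next s (xi : X) (Ui : set X) :
    partial_play S s -> open Ui -> Ui xi -> Ui `<=` S s ->
    partial_play S (rcons s (xi, Ui)).

Definition legal S : Prop :=
  forall s (xi : X) (Ui : set X), partial_play S (rcons s (xi, Ui)) ->
    [/\ open (S (rcons s (xi, Ui))), S (rcons s (xi, Ui)) xi
      & S (rcons s (xi, Ui)) `<=` Ui].

Definition play x U V : Prop :=
  (forall i, open (U i) /\ U i (x i)) /\
  (forall i, U i.+1 `<=` V i) /\
  (forall i, [/\ open (V i), V i (x i) & V i `<=` U i]).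

Definition follows S x U V : Prop :=
  forall i, V i = S [seq (x j, U j) | j <- iota 0 i.+1].

Definition interleave U V : nat -> set X :=
  fun n => if odd n then V n./2 else U n./2.

Definition nonempty_wins P U V : Prop := P (interleave U V).

Definition winning_strategy P S : Prop :=
  legal S /\
  forall x U V, play x U V -> follows S x U V -> nonempty_wins P U V.

Definition stationary S : Prop :=
  forall s m, partial_play S (rcons s m) -> S (rcons s m) = S [:: m].

End Game.

Arguments move : clear implicits.
Arguments strategy : clear implicits.

(* Main.v *)
(* By open-finiteness, proper reverse inclusion is well founded on the basis.
   By recursion along it, each basic U receives a finite set of histories against
   the given strategy T, and a point x of U is answered by a basic W inside all
   of T's answers to (x, U) after these histories. The answer W may not determine
   x, so a representative point y with the same answer is fixed for each pair
   (U, W). Replacing Empty's moves by the representatives turns a play against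
   the stationary strategy into a play against T whose history at U is among the
   finitely many recorded ones, because it is built from basic sets above U.
   This requires strictly shrinking moves. Rounds in which Empty repeats a basic
   set are therefore skipped, unless the set is repeated forever; in that case it
   is a least neighborhood of the representative, and T has no choice. *)
Require Import Defs.
From mathcomp Require Import all_boot all_order finmap.
From mathcomp Require Import all_classical topology.

Local Open Scope classical_set_scope.

Lemma nbhs_bigcap_finite (X : topologicalType) (I : choiceType) (D : set I)
    (f : I -> set X) (x : X) :
  finite_set D -> (forall i, D i -> nbhs x (f i)) ->
  nbhs x (\bigcap_(i in D) f i).
Proof.
move=> finD nf; rewrite -(fset_setK finD).
by apply: filter_bigI => i; rewrite in_fset_set // inE; exact: nf.
Qed.

Lemma basis_refine {X : topologicalType} {B : set (set X)} {x : X} {O : set X} :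
  basis B -> nbhs x O -> exists W, [/\ B W, W x & W `<=` O].
Proof. by case=> _ /(_ x O) h /h [W [BW Wx] WO]; exists W. Qed.

Definition proper_above {X : Type} (B : set (set X)) (V U : set X) : Prop :=
  [/\ B V, B U, U `<=` V & V <> U].

(** The number of basic supersets is a rank: every basic superset of [V] is one of [U], while [U]
    itself is lost. *)
Lemma wf_proper_above {X : topologicalType} {B : set (set X)} :
  open_finite B -> well_founded (proper_above B).
Proof.
move=> ofB.
pose up U := [set V | B V /\ U `<=` V].
have finup U : B U -> finite_set (up U) := ofB U.
have acc n : forall U, B U -> (#|` fset_set (up U)| < n)%N ->
    Acc (proper_above B) U.
  elim: n => [U _|n IH U BU ltU]; first by rewrite ltn0.
  constructor => V [BV _ UV neVU].
  apply: (IH V BV); rewrite -ltnS; apply: leq_trans _ ltU; rewrite ltnS.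
  apply: fproper_ltn_card; rewrite fproperEneq; apply/andP; split.
    apply/eqP => eq_up; apply: neVU; rewrite eqEsubset; split=> //.
    have : up U U by split.
    by rewrite -(fset_setK (finup U BU)) -eq_up (fset_setK (finup V BV)) => -[].
  apply/fsubsetP => W; rewrite !in_fset_set ?inE; [|exact: finup..].
  by case=> BW VW; split=> //; exact: subset_trans VW.
move=> U; have [BU|nBU] := pselect (B U); first exact: acc (ltnSn _).
by constructor => V [].
Qed.

Section Construction.
Context {X : topologicalType} (B : set (set X)) (T : strategy X) (x0 : X).
Context (basisB : basis B) (openfinB : open_finite B) (legalT : legal T).

(* Junk value x0 when W is not an answer at a point of W. *)
Definition representative (f : X -> set X) (W : set X) : X :=
  xget x0 [set y | W y /\ f y = W].

(* The last clause allows W = U only when U is the least neighborhood of x. *)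
Definition answers (H : set (seq (move X))) (U : set X) (x : X)
    : set (set X) :=
  [set W | [/\ B W, W x, W `<=` U,
    forall s, H s -> partial_play T (rcons s (x, U)) ->
      W `<=` T (rcons s (x, U))
    & W = U -> forall O, open O -> O x -> U `<=` O]].

(* [rec V] is the pair of the histories and the answers at V. *)
Definition histories_step (U : set X)
    (rec : forall V, proper_above B V U ->
      set (seq (move X)) * (X -> set X)) : set (seq (move X)) :=
  [set s | s = [::] \/ exists V (h : proper_above B V U) W s',
    [/\ B W, U `<=` W, (rec V h).1 s'
      & s = rcons s' (representative (rec V h).2 W, V)]].

Definition table : set X -> set (seq (move X)) * (X -> set X) :=
  Fix (wf_proper_above openfinB) (fun=> _) (fun U rec =>
    (histories_step U rec,
     fun x => xget U (answers (histories_step U rec) U x))).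

Definition histories (U : set X) : set (seq (move X)) := (table U).1.

Definition answer (U : set X) (x : X) : set X := (table U).2 x.

Lemma tableE U : table U =
  (histories_step U (fun V _ => table V),
   fun x => xget U (answers (histories_step U (fun V _ => table V)) U x)).
Proof.
rewrite {1}/table Fix_eq // => V f g fg.
suff -> : f = g by [].
by apply: functional_extensionality_dep => W;
  apply: functional_extensionality_dep => h.
Qed.

Lemma answerE U x : answer U x = xget U (answers (histories U) U x).
Proof. by rewrite /answer /histories tableE. Qed.

Lemma histories_nil U : histories U [::].
Proof. by rewrite /histories tableE; left. Qed.

Lemma histories_rcons U V W s : proper_above B V U -> B W -> U `<=` W ->
  histories V s -> histories U (rcons s (representative (answer V) W, V)).
Proof.
by move=> VU BW UW Hs; rewrite /histories tableE; right; exists V, VU, W, s.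
Qed.

(** A nonempty history is fixed by [V], [W] and a history at [V]. Both sets lie above [U], so
    open-finiteness leaves finitely many choices of them, and induction bounds the rest. *)
Lemma finite_histories U : B U -> finite_set (histories U).
Proof.
elim/(well_founded_ind (wf_proper_above openfinB)): U => U IH BU.
pose up := [set V | B V /\ U `<=` V].
pose above := [set V | proper_above B V U].
pose ext V W := [set rcons s (representative (answer V) W, V) | s in histories V].
apply: (@sub_finite_set _ _
    ([set [::]] `|` \bigcup_(V in above) \bigcup_(W in up) ext V W)).
  move=> s; rewrite /histories tableE => -[->|]; first by left.
  move=> [V [VU [W [s' [BW UW Hs' ->]]]]].
  by right; exists V => //; exists W => //; exists s'.
rewrite finite_setU; split; first exact: finite_set1.
apply: bigcup_finite => [|V VU].
  by apply: sub_finite_set (openfinB U BU) => V [].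
apply: bigcup_finite => [|W _]; first exact: openfinB.
by apply: finite_image; apply: IH => //; case: VU.
Qed.

Lemma answersP U x : B U -> U x -> answers (histories U) U x (answer U x).
Proof.
move=> BU Ux; rewrite answerE; apply: xgetPex.
have openU : open U by case: basisB => + _; exact.
pose D := histories U `&` [set s | partial_play T (rcons s (x, U))].
have nT : nbhs x (\bigcap_(s in D) T (rcons s (x, U))).
  apply: nbhs_bigcap_finite.
    exact: sub_finite_set (@subIsetl _ _ _) (finite_histories U BU).
  by move=> s [_ ps]; have [oT Tx _] := legalT _ _ _ ps; exact: open_nbhs_nbhs.
have nU : nbhs x U by exact: open_nbhs_nbhs.
have [minU|/existsNP[O /not_implyP[oO /not_implyP[Ox nUO]]]] :=
    pselect (forall O, open O -> O x -> U `<=` O).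
  have [W [BW Wx WI]] := basis_refine basisB (filterI nU nT).
  exists W; split=> // [y /WI[]//|s Hs ps y /WI[_]].
  by apply; split.
(* Staying inside [O], which does not contain [U], excludes [W = U]. *)
have nO : nbhs x O by exact: open_nbhs_nbhs.
have [W [BW Wx WI]] := basis_refine basisB (filterI nO (filterI nU nT)).
exists W; split=> // [y /WI[_ []]//|s Hs ps y /WI[_ [_]]|WU].
  by apply; split.
by exfalso; apply: nUO; rewrite -WU => y /WI[].
Qed.

Lemma representativeP U x : B U -> U x ->
  let W := answer U x in let y := representative (answer U) W in
  W y /\ answer U y = W.
Proof.
move=> BU Ux; have [_ Wx _ _ _] := answersP U x BU Ux.
by apply: (@xgetPex _ x0 [set y | answer U x y /\ answer U y = answer U x]);
  exists x.
Qed.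

(** Histories grow only along proper inclusions, so they bound [V n] only while all earlier moves
    shrink; after a repetition the last hypothesis supplies [V n = U n] instead. *)
Lemma simulation (x : nat -> X) (U V : nat -> set X) :
  (forall i, B (U i) /\ U i (x i)) -> (forall i, V i = answer (U i) (x i)) ->
  (forall i, U i.+1 `<=` V i) ->
  (forall n, V n = U n \/ forall i, (i < n)%N -> U i.+1 <> U i) ->
  exists (y : nat -> X) (R : nat -> set X),
    [/\ play y U R, follows T y U R & forall n, V n `<=` R n].
Proof.
move=> BUx VE UV sparse.
pose y i := representative (answer (U i)) (V i).
pose mv i : move X := (y i, U i).
have Vy i : V i (y i) /\ answer (U i) (y i) = V i.
  by have [BU Ux] := BUx i; rewrite /y VE; exact: representativeP.
have BU i : B (U i) by case: (BUx i).
have openU i : open (U i) by case: basisB => + _; exact.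
have VU i : V i `<=` U i.
  by have [? Ux] := BUx i; have [_ _ + _ _] := answersP _ _ (BU i) Ux; rewrite -VE.
have Uy i : U i (y i) by apply: VU; case: (Vy i).
have hist n : (forall i, (i < n)%N -> U i.+1 <> U i) ->
    histories (U n) (mkseq mv n).
  elim: n => [_|n IH dist]; first exact: histories_nil.
  rewrite mkseqS; apply: histories_rcons => //; last first.
  - by apply: IH => i lin; apply: dist; exact: ltnW.
  - by have [_ Ux] := BUx n; have [+ _ _ _ _] := answersP _ _ (BU n) Ux; rewrite -VE.
  - split=> //; first exact: subset_trans (UV n) (VU n).
    by move=> E; exact: (dist n (ltnSn n)).
pose R n := T (mkseq mv n.+1).
have legalR n : partial_play T (mkseq mv n.+1) ->
    [/\ open (R n), R n (y n) & R n `<=` U n].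
  by rewrite /R mkseqS; exact: legalT.
have VR n : partial_play T (mkseq mv n.+1) -> V n `<=` R n.
  move=> pp; have [oR Ry _] := legalR n pp.
  (* The clauses are applied at [y n] rather than [x n]: both points have the answer [V n], and [T]
     sees [y n]. *)
  have [_ _ _ below minU] := answersP _ _ (BU n) (Uy n).
  have [_ eqV] := Vy n; rewrite eqV in below minU.
  have [VnU|/hist Hn] := sparse n; first by rewrite VnU; exact: minU.
  by move: pp; rewrite /R mkseqS; exact: below.
(* Legality propagates because [U n.+1] lies in [V n], hence in the answer [R n] of [T]. *)
have pp n : partial_play T (mkseq mv n.+1).
  elim: n => [|n IH]; first exact: partial_play_start.
  rewrite mkseqS; apply: partial_play_next => //.
  exact: subset_trans (UV n) (VR n IH).
exists y, R; split=> [|//|n]; last exact: VR.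
split; first by move=> i; split.
split; first by move=> i; exact: subset_trans (UV i) (VR i (pp i)).
by move=> i; exact: legalR.
Qed.

End Construction.

(** Each index is chosen where the next set differs or, if no such place lies ahead, in the constant
    tail; restarting the search at [n.+1] makes the indices increase. *)
Lemma sparse_subsequence {X : Type} (U : nat -> set X) :
  exists idx : nat -> nat, (forall k, (idx k < idx k.+1)%N) /\
    forall n, U (idx n).+1 = U (idx n) ->
      forall j, (idx n <= j)%N -> U j = U (idx n).
Proof.
have next n : exists j, (n <= j)%N /\
    (U j.+1 = U j -> forall k, (j <= k)%N -> U k = U j).
  have [const|/existsNP[j /not_implyP[nj neq]]] :=
      pselect (forall j, (n <= j)%N -> U j.+1 = U j).
    exists n; split=> // _; elim=> [|k IH]; first by rewrite leqn0 => /eqP ->.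
    rewrite leq_eqVlt => /orP[/eqP -> //|]; rewrite ltnS => nk.
    by rewrite const // IH.
  by exists j.
have [f fP] := choice next.
exists (fun k => iter k (fun n => f n.+1) (f 0%N)); split=> [k|[|n]] /=.
- by case: (fP (iter k (fun n => f n.+1) (f 0%N)).+1).
- by case: (fP 0%N).
- by case: (fP (iter n (fun n => f n.+1) (f 0%N)).+1).
Qed.

Lemma descending_interleave (X : topologicalType) (x : nat -> X)
    (U V : nat -> set X) : play x U V -> descending (interleave U V).
Proof.
move=> [oU [UV VP]]; split=> [i|].
  by rewrite /interleave; case: ifP => _; [case: (VP i./2)|case: (oU i./2)].
apply: (@homo_leq _ _ (fun A C => C `<=` A)) => [A //|A C D CA DC|i].
  exact: subset_trans CA.
rewrite /interleave /= uphalf_half; case: (odd i) => /=.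
  by rewrite add1n; exact: UV.
by rewrite add0n; case: (VP i./2).
Qed.

Lemma interleave_le {X : topologicalType} {x : nat -> X} {U V : nat -> set X}
    (U' V' : nat -> set X) : play x U V ->
  (forall k, exists j, U' j `<=` V k) ->
  seq_le (interleave U' V') (interleave U V).
Proof.
move=> [_ [_ VP]] UV' j; have [i U'V] := UV' j./2; exists i.*2.
rewrite /interleave odd_double doubleK; case: ifP => // _.
by apply: subset_trans U'V _; case: (VP j./2).
Qed.

Theorem theorem16 (X : topologicalType) (B : set (set X))
    (P : set (nat -> set X))
    (basisB : basis B) (openfinB : open_finite B)
    (propP : is_property P) (invP : invariant_property P) :
  (exists S : strategy X, winning_strategy P S) ->
  exists S : strategy X, winning_strategy P S /\ stationary S.
Proof.
move=> [T [legalT winT]].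
(* [x0] is the default point of the construction; without points Empty has no move and [T] is
   vacuously stationary. *)
have [[x0 _]|noX] := pselect (exists x : X, True); last first.
  exists T; split; first by split.
  by move=> s [x]; exfalso; apply: noX; exists x.
(* The recursion handles basic sets only, so Empty's open set is first shrunk to a basic one that
   depends on the current move alone, which keeps [S] stationary. *)
pose u (m : move X) := xget setT [set W | [/\ B W, W m.1 & W `<=` m.2]].
have uP x U : open U -> U x -> [/\ B (u (x, U)), u (x, U) x & u (x, U) `<=` U].
  move=> oU Ux; apply: (@xgetPex _ setT [set W | [/\ B W, W x & W `<=` U]]).
  by apply: (basis_refine basisB); exact: open_nbhs_nbhs.
pose ans := answer B T x0 openfinB.
have ansP x U : B U -> U x -> [/\ B (ans U x), ans U x x, ans U x `<=` U
    & ans U x = U -> forall O, open O -> O x -> U `<=` O].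
  by move=> BU Ux; have [] := answersP B T x0 basisB openfinB legalT U x BU Ux.
pose S : strategy X := fun s =>
  let m := last (x0, setT) s in ans (u m) m.1.
have SE s m : S (rcons s m) = ans (u m) m.1 by rewrite /S last_rcons.
exists S; split; last by move=> s m _; rewrite SE.
have openB W : B W -> open W by case: basisB => + _; exact.
split.
  move=> s x U pp.
  have [oU Ux] : open U /\ U x.
    inversion pp as [y W oW Wy eqs|s' y W _ oW Wy _ eqs].
      by case: s eqs {pp} => [|? []] //= [<- <-].
    by move/rcons_inj: eqs => [_ <- <-].
  rewrite SE; have [Bu ux uU] := uP x U oU Ux.
  have [Bw wx wu _] := ansP _ _ Bu ux.
  by split=> //; [exact: openB|exact: subset_trans uU].
move=> x U V pl follow; have [oU [UV VP]] := pl.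
pose A i := u (x i, U i).
have AP i : [/\ B (A i), A i (x i) & A i `<=` U i].
  by have [oUi Ux] := oU i; exact: uP.
have VE i : V i = ans (A i) (x i).
  by rewrite follow -[map _ _]/(mkseq _ i.+1) mkseqS SE.
have VA i : V i `<=` A i.
  by have [BA Ax _] := AP i; rewrite VE; case: (ansP _ _ BA Ax).
have AV i : A i.+1 `<=` V i.
  by have [_ _ AU] := AP i.+1; exact: subset_trans (UV i).
have leA i j : (i <= j)%N -> A j `<=` A i.
  apply: (@homo_leq _ _ (fun A C => C `<=` A)) => [C //|C D E DC ED|k].
    exact: subset_trans DC.
  exact: subset_trans (VA k).
have [idx [idxS sparse]] := sparse_subsequence A.
have idx_ge k : (k <= idx k)%N.
  by elim: k => // k IH; exact: leq_ltn_trans (idxS k).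
have idx_lt i j : (i < j)%N -> (idx i < idx j)%N.
  by apply: (@homo_ltn _ idx (fun a b => (a < b)%N)) => // a b c; exact: ltn_trans.
have [||||y [R [plR folR VR]]] := simulation B T x0 basisB openfinB legalT
    (x \o idx) (A \o idx) (V \o idx).
- by move=> i /=; case: (AP (idx i)).
- by move=> i; exact: VE.
- move=> i /=; exact: subset_trans (leA _ _ (idxS i)) (AV _).
- move=> n /=.
  (* If [A] repeats just after [idx n], then [V (idx n)] is squeezed between equal sets. Otherwise
     an earlier equality would make [A] constant from there on, against the change at [idx n]. *)
  have [stable|move_on] := pselect (A (idx n).+1 = A (idx n)).
    left; rewrite eqEsubset; split; first exact: VA.
    by rewrite -{1}stable; exact: AV.
  right=> i lin eqA; apply: move_on.
  have eqA' : A (idx i).+1 = A (idx i).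
    rewrite eqEsubset; split; first exact: leA.
    by rewrite -{1}eqA; apply: leA; exact: idxS.
  have le_in := ltnW (idx_lt _ _ lin).
  by rewrite !(sparse i eqA') // ltnW.
(* [T] wins the simulated play, and the two interleavings are cofinal in each other, so invariance
   transfers the win. *)
apply: (invP (interleave U V) (interleave (A \o idx) R)).
- exact: descending_interleave pl.
- exact: winT plR folR.
split.
  apply: (interleave_le U V plR) => k; exists (idx k).+1.
  exact: subset_trans (UV _) (VR k).
apply: (interleave_le (A \o idx) R pl) => k; exists k.+1.
by apply: subset_trans (AV k); apply: leA; exact: idx_ge.
Qed.
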